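(* Let $h:\mathbb{R}\to\mathbb{R}$ and $\varphi:(0,\infty)\to(0,\infty)$ be functions of class $\mathbf{\Delta}^1_2$ (i.e. with $\mathbf{\Delta}^1_2$ graphs), and let $\mathcal{U}$ be an ultrafilter on $\omega$ of class $\mathbf{\Delta}^1_2$. Then the function $$K_h^{\mathcal{U}}(t):=\mathcal{U}\text{-}\lim_{n}\,[h(n+t\varphi(n))-h(n)]$$ is of class $\mathbf{\Delta}^1_2$.
   Context: The classes are those of the (boldface) projective hierarchy in Euclidean space: $\mathbf{\Sigma}^1_1$ denotes the analytic sets, $\mathbf{\Pi}^1_1$ their complements, $\mathbf{\Sigma}^1_{2}$ the projections of $\mathbf{\Pi}^1_1$ sets, $\mathbf{\Pi}^1_{2}$ the complements of $\mathbf{\Sigma}^1_{2}$ sets, and $\mathbf{\Delta}^1_2:=\mathbf{\Sigma}^1_2\cap\mathbf{\Pi}^1_2$. Functions are identified with their graphs. Sets of natural numbers are identified with real numbers via indicator functions, so an ultrafilter on $\omega$ is regarded as a subset of $\mathbb{R}$. $\mathcal{U}\text{-}\lim_n$ denotes the limit along $\mathcal{U}$ (in the extended real line). *)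

(* Defs.v *)
From HB Require Import structures.
From mathcomp Require Import all_boot all_order all_algebra.
From mathcomp Require Import all_classical all_reals all_analysis.
From mathcomp Require Import measurable_realfun.

Set Implicit Arguments.
Unset Strict Implicit.
Unset Printing Implicit Defensive.

Import Order.TTheory GRing.Theory Num.Theory.
Import numFieldNormedType.Exports.

Local Open Scope classical_set_scope.
Local Open Scope ring_scope.

(* The boldface classes Sigma^1_1, Pi^1_1, Sigma^1_2, Pi^1_2, Delta^1_2.
   They are meant for R, for the extended real line \bar R and for finite
   products of these, where the library's measurable sets are exactly the
   Borel sets; the auxiliary projected coordinate always ranges over R. *)
Section projective_classes.
Context {R : realType}.

Definition projection (T : Type) (B : set (T * R)) : set T :=
  [set x | exists y, B (x, y)].

Definition sigma11 d (T : measurableType d) (A : set T) : Prop :=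
  exists2 B : set (T * R), measurable B & A = projection B.

Definition pi11 d (T : measurableType d) (A : set T) : Prop := sigma11 (~` A).

Definition sigma12 d (T : measurableType d) (A : set T) : Prop :=
  exists2 C : set (T * R), pi11 C & A = projection C.

Definition pi12 d (T : measurableType d) (A : set T) : Prop := sigma12 (~` A).

Definition delta12 d (T : measurableType d) (A : set T) : Prop :=
  sigma12 A /\ pi12 A.

End projective_classes.

Arguments sigma11 R {d T} A.
Arguments pi11 R {d T} A.
Arguments sigma12 R {d T} A.
Arguments pi12 R {d T} A.
Arguments delta12 R {d T} A.

Definition graph (S T : Type) (D : set S) (f : S -> T) : set (S * T) :=
  [set p | D p.1 /\ p.2 = f p.1].

(* The indicator function of A, as a point of 2^omega, is identified with
   a real number through the usual homeomorphism of 2^omega with the Cantor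
   ternary set; unlike binary expansion, this coding is injective. *)
Definition real_of_natset (R : realType) (A : set nat) : R :=
  limn (series (fun n : nat => 2 * (\1_A n : R) / 3 ^+ n.+1)).

Definition reals_of_family (R : realType) (U : set_system nat) : set R :=
  [set real_of_natset R A | A in U].

Arguments reals_of_family R U : clear implicits.

(* The limit is taken in the compact Hausdorff space \bar R, so that it always
   exists when U is an ultrafilter.  Functions phi on (0, +oo) are represented
   by arbitrary extensions to R: phi 0 is unconstrained, and can only matter
   when U is the principal ultrafilter at 0. *)
Definition ultra_kernel (R : realType) (U : set_system nat)
    (h phi : R -> R) (t : R) : \bar R :=
  lim ((fun n : nat => (h (n%:R + t * phi n%:R) - h n%:R)%:E) @ U).

(* Main.v *)
Require Import Defs.
From HB Require Import structures.
From mathcomp Require Import all_boot all_order all_algebra.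
From mathcomp Require Import all_classical all_reals all_analysis.
From mathcomp Require Import measurable_realfun.
From mathcomp Require Import lra.

Set Implicit Arguments.
Unset Strict Implicit.
Unset Printing Implicit Defensive.

Import Order.TTheory GRing.Theory Num.Theory.
Import numFieldNormedType.Exports.

Local Open Scope classical_set_scope.
Local Open Scope ring_scope.

(** Write f_n(t) = h(n + t * phi(n)) - h(n).  The numbers phi(n) and h(n) are
    countably many constants, so in boldface classes they act as parameters:
    for V Borel, f_n(t) is in V iff some u satisfies
    (n + t * phi(n), u) in graph(h) and u - h(n) in V, which is Sigma^1_2
    in t ([increment_sigma12]).

    As U is upward closed, {n | f_n(t) in V} belongs to U iff some real y codes
    an A in U such that f_n(t) is in V for every n in A.  Decoding y is Borel,
    since the ternary digits of a point of the Cantor set are Borel functions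
    of it, and so this condition is Sigma^1_2 as well
    ([ultra_increment_sigma12]).  In \bar R, a point L is the limit of f_n(t)
    along U iff each rational ray that is a neighbourhood of L contains f_n(t)
    for U-many n; these are countably many conditions, so the graph of the
    kernel is Sigma^1_2 ([graph_ultra_kernel_sigma12]).

    A function with values in \bar R and Sigma^1_2 graph has a Delta^1_2 graph:
    (t, L) lies off the graph iff some (t, L') with L' <> L lies on it
    ([sigma12_graphC]).

    What this uses of Sigma^1_2 is closure under Borel preimages, unions with
    Borel sets, countable intersections and projections.  The last two rest on
    one fact: there are Borel functions R -> R, indexed by nat, that jointly map
    R onto the set of all sequences of reals ([real_code_surj]).  They are built
    from the same ternary digits: the digits of y form a subset of nat, and a
    sequence of extended reals is a subset of nat through its Dedekind cuts. *)

(** * Ternary coding of sets of natural numbers *)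

Section cantor_coding.
Context {R : realType}.
Implicit Types (A : set nat) (y : R).

Let ternary A n : R := 2 * \1_A n / 3 ^+ n.+1.

Lemma ternary_ge0 A n : 0 <= ternary A n.
Proof. by rewrite divr_ge0 ?exprn_ge0// mulr_ge0. Qed.

Lemma ternary_le A n : ternary A n <= geometric (2 / 3) 3^-1 n.
Proof.
rewrite /ternary /geometric /= exprS invfM exprVn !mulrA.
rewrite ler_pM2r ?invr_gt0 ?exprn_gt0// ler_pM2r ?invr_gt0//.
by rewrite -[leRHS]mulr1 ler_pM2l// indicE lern1; case: (_ \in _).
Qed.

Lemma third_lt1 : `|3^-1 : R| < 1.
Proof. by rewrite ger0_norm ?invr_ge0// invf_lt1// ltr1n. Qed.

Lemma is_cvg_ternary A : cvgn (series (ternary A)).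
Proof.
apply: (series_le_cvg (ternary_ge0 A) _ (ternary_le A)).
  by move=> n; rewrite (le_trans (ternary_ge0 A n) (ternary_le A n)).
exact/is_cvg_geometric_series/third_lt1.
Qed.

Lemma real_of_natset_itv A : 0 <= real_of_natset R A <= 1.
Proof.
apply/andP; split.
  apply: limr_ge; first exact: is_cvg_ternary.
  by apply: nearW => n; rewrite sumr_ge0// => i _; exact: ternary_ge0.
apply: limr_le; first exact: is_cvg_ternary.
apply: nearW => n.
apply: (@le_trans _ _ (series (geometric (2 / 3) 3^-1) n)).
  by apply: ler_sum => i _; exact: ternary_le.
have a_ge0 : 0 <= 2 / 3 :> R by lra.
have x_gt0 : 0 < 3^-1 :> R by lra.
apply: (le_trans (geometric_le_lim n a_ge0 x_gt0 third_lt1)).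
have -> : 1 - 3^-1 = 2 / 3 :> R by lra.
by rewrite divff// gt_eqF//; lra.
Qed.

(** Self-similarity of the Cantor set: it reduces all decoding to the digit of
    index 0, by induction along the shift. *)
Lemma real_of_natsetS A :
  3 * real_of_natset R A = 2 * \1_A 0%N + real_of_natset R [set n | A n.+1].
Proof.
set A' := [set n | A n.+1].
have recE n : series (ternary A) n.+1 =
    2 / 3 * \1_A 0%N + 3^-1 * series (ternary A') n.
  rewrite /series /= big_nat_recl// big_mkord big_mkord mulr_sumr.
  congr (_ + _); first by rewrite /ternary expr1 mulrAC.
  apply: eq_bigr => i _; rewrite /ternary (exprS _ i.+1) invfM.
  have -> : \1_A i.+1 = \1_A' i :> R by [].
  by rewrite [RHS]mulrCA mulrA.
have : series (ternary A) @ \oo -->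
    2 / 3 * \1_A 0%N + 3^-1 * real_of_natset R A'.
  rewrite -cvg_shiftS (eq_cvg _ _ recE).
  apply: cvgD; first exact: cvg_cst.
  by apply: cvgMr; exact: is_cvg_ternary.
move=> /cvg_lim; rewrite -/(real_of_natset R A) => -> //.
rewrite /real_of_natset; lra.
Qed.

(** On the Cantor set, the map deleting the first ternary digit.  That digit is
    2 * \1_A 0, so the code lies in [0, 1/3] or in [2/3, 1]; any cut strictly
    between 1/3 and 2/3 tells the two cases apart, and 1/2 is used. *)
Definition ternary_shift y : R := if 2^-1 <= y then 3 * y - 2 else 3 * y.

Definition ternary_digit n : set R := [set y | 2^-1 <= iter n ternary_shift y].

Lemma real_of_natset_digit0 A : 2^-1 <= real_of_natset R A <-> A 0%N.
Proof.
have := real_of_natset_itv [set n | A n.+1].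
have := real_of_natsetS A; rewrite indicE.
have [/set_mem A0|/negP nA0] := boolP (0%N \in A); rewrite ?(mulr1n,mulr0n).
  by move=> E /andP[? ?]; split => // _; lra.
move=> E /andP[? ?]; split; last by move/mem_set.
by move=> ?; exfalso; lra.
Qed.

Lemma ternary_shift_real_of_natset A :
  ternary_shift (real_of_natset R A) = real_of_natset R [set n | A n.+1].
Proof.
have := real_of_natsetS A; rewrite /ternary_shift indicE.
have [/real_of_natset_digit0/mem_set ->|] := ifPn; first by rewrite mulr1n; lra.
have [/set_mem/real_of_natset_digit0 ->//|_] := boolP (0%N \in A).
by rewrite mulr0n; lra.
Qed.

Lemma ternary_digit_real_of_natset n A :
  ternary_digit n (real_of_natset R A) <-> A n.
Proof.
rewrite /ternary_digit /=; elim: n A => [|n IHn] A.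
  exact: real_of_natset_digit0.
by rewrite iterSr ternary_shift_real_of_natset IHn.
Qed.

Lemma measurable_ternary_digit n : measurable (ternary_digit n).
Proof.
have mhalf : measurable [set y : R | 2^-1 <= y].
  by rewrite -set_itvcy; exact: measurable_itv.
have mshift : measurable_fun setT ternary_shift.
  apply: measurable_fun_ifT.
  - by apply: (measurable_fun_bool true); rewrite setTI.
  - by apply: measurable_funB => //; exact: mulrl_measurable.
  - exact: mulrl_measurable.
suff miter : measurable_fun setT (iter n ternary_shift).
  by rewrite -[X in measurable X]setTI; exact: (miter measurableT _ mhalf).
elim: n => [|n IHn] /=; first exact: measurable_id.
exact: measurableT_comp mshift IHn.
Qed.

End cantor_coding.

(** * Coding sequences of extended reals by reals *)

Section ereal_coding.
Context {R : realType}.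
Local Open Scope ereal_scope.

Lemma ereal_rat_between (x y : \bar R) :
  x < y -> exists q : rat, x < (ratr q)%:E < y.
Proof.
have between (a b : R) : (a < b)%R ->
    exists q : rat, a%:E < (ratr q)%:E < b%:E.
  by move=> /rat_in_itvoo[q]; rewrite in_itv /= -!lte_fin; exists q.
case: x => [x| |]; case: y => [y| |]//; rewrite ?lte_fin => xy.
- exact: between.
- have [|q /andP[xq _]] := between x (x + 1)%R; first by rewrite ltrDl.
  by exists q; rewrite xq ltry.
- have [|q /andP[_ qy]] := between (y - 1)%R y; first by rewrite gtrBl.
  by exists q; rewrite qy ltNyr.
- by exists 0%R; rewrite ltNyr ltry.
Qed.

(** The digits of y whose index encodes a pair (n, q) single out a set of
    rationals q; its supremum is the n-th term of the sequence coded by y.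
    Values in \bar R make the supremum total, and also let R parametrize
    \bar R. *)
Definition ereal_code (n : nat) (y : R) : \bar R :=
  ereal_sup [set (ratr q)%:E | q in
    [set q : rat | ternary_digit (pickle (n, q)) y]].

(** Each term is recovered as the supremum of the rationals below it. *)
Lemma ereal_code_surj (w : nat -> \bar R) :
  exists y : R, forall n, ereal_code n y = w n.
Proof.
pose y := real_of_natset R
  [set k | exists n (q : rat), k = pickle (n, q) /\ (ratr q)%:E < w n].
have codeE n q : ternary_digit (pickle (n, q)) y <-> (ratr q)%:E < w n.
  rewrite ternary_digit_real_of_natset; split; last by exists n, q.
  by move=> [m [r [/(pcan_inj pickleK)[-> ->]]]].
exists y => n; apply/eqP; rewrite eq_le; apply/andP; split.
  by apply: ge_ereal_sup => _ [q /codeE/ltW qw <-].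
rewrite leNgt; apply/negP => /ereal_rat_between[q /andP[supq /codeE qy]].
move: supq; apply/negP; rewrite -leNgt.
by apply: ereal_sup_ubound; exists q.
Qed.

Lemma measurable_ereal_code n : measurable_fun setT (ereal_code n).
Proof.
move=> _; apply: (measurability _ (ErealGenOInfty.measurableE R)) => //.
move=> _ [_ [x ->] <-]; rewrite setTI.
rewrite (_ : _ @^-1` _ = \bigcup_(q : rat) (
    if (x%:E < (ratr q)%:E) then ternary_digit (pickle (n, q)) else set0)).
  apply: bigcupT_measurable_rat => q; case: ifP => _ //.
  exact: measurable_ternary_digit.
apply/seteqP; split => y /=; rewrite in_itv /= andbT.
  by move=> /ereal_sup_gt[_ [q qy <-] xq]; exists q; rewrite // xq.
move=> [q _]; case: ifP => // xq qy; apply: (lt_le_trans xq).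
by apply: ereal_sup_ubound; exists q.
Qed.

Definition real_code (n : nat) (y : R) : R := fine (ereal_code n y).

Lemma real_code_surj (w : nat -> R) :
  exists y : R, forall n, real_code n y = w n.
Proof.
have [y yw] := ereal_code_surj (EFin \o w).
by exists y => n; rewrite /real_code yw.
Qed.

Lemma measurable_real_code n : measurable_fun setT (real_code n).
Proof.
exact: measurableT_comp (fine_measurable measurableT) (measurable_ereal_code n).
Qed.

End ereal_coding.

(** * Closure properties of the class Sigma^1_2 *)

Section sigma12_closure.
Context {R : realType}.

(** Prenex form, with the two quantifiers made explicit: closure under an
    operation is then a matter of finding the new Borel matrix B. *)
Lemma sigma12P d (T : measurableType d) (A : set T) :
  sigma12 R A <-> exists2 B : set (T * R * R), measurable B &
    A = [set x | exists y, forall z, B (x, y, z)].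
Proof.
split=> [[C [B mB CB ->]]|[B mB ->]].
  exists (~` B); first exact: measurableC.
  apply/seteqP; split => x [y xy]; exists y.
    by move=> z Bxyz; suff : (~` C) (x, y) by []; rewrite CB; exists z.
  by apply: contrapT => nC; have : (~` C) (x, y) := nC; rewrite CB => -[z] /xy.
exists [set p | forall z, B (p, z)]; last by [].
exists (~` B); first exact: measurableC.
by apply/seteqP; split => p /=; [move/existsNP|move=> [z nB] /(_ z)].
Qed.

Lemma measurable_preimage d d' (T : measurableType d) (S : measurableType d')
  (f : T -> S) (B : set S) :
  measurable_fun setT f -> measurable B -> measurable (f @^-1` B).
Proof. by move=> mf mB; rewrite -[X in measurable X]setTI; exact: mf. Qed.

Lemma sigma12_preimage d d' (T : measurableType d) (S : measurableType d')
  (f : T -> S) (A : set S) :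
  measurable_fun setT f -> sigma12 R A -> sigma12 R (f @^-1` A).
Proof.
move=> mf /sigma12P[B mB ->]; apply/sigma12P.
exists ((fun p : T * R * R => (f p.1.1, p.1.2, p.2)) @^-1` B) => //.
apply: measurable_preimage mB.
apply: measurable_fun_pair => //; apply: measurable_fun_pair.
  exact: measurableT_comp mf (measurableT_comp _ _).
exact: measurableT_comp.
Qed.

Lemma measurable_sigma12 d (T : measurableType d) (A : set T) :
  measurable A -> sigma12 R A.
Proof.
move=> mA; apply/sigma12P; exists ((fun p : T * R * R => p.1.1) @^-1` A).
  by apply: measurable_preimage mA; exact: measurableT_comp.
by apply/seteqP; split => [x Ax|x [_ /(_ 0)]//]; exists 0.
Qed.

Lemma sigma12_setU_measurable d (T : measurableType d) (A B : set T) :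
  measurable A -> sigma12 R B -> sigma12 R (A `|` B).
Proof.
move=> mA /sigma12P[C mC ->]; apply/sigma12P.
exists ((fun p : T * R * R => p.1.1) @^-1` A `|` C).
  apply: measurableU mC.
  by apply: measurable_preimage mA; exact: measurableT_comp.
apply/seteqP; split => x.
  by move=> [Ax|[y Cxy]]; [exists 0 => z; left|exists y => z; right].
move=> [y ACy]; have [Ax|nAx] := pselect (A x); [by left|right].
by exists y => z; case: (ACy z).
Qed.

(** In (forall i, exists y_i, forall z, B_i(x, y_i, z)), a single real y codes
    all the witnesses y_i, and the quantifier over z commutes with the countable
    intersection, which is absorbed by the Borel matrix. *)
Lemma sigma12_bigcap d (T : measurableType d) (J : countType)
  (A : J -> set T) : (forall i, sigma12 R (A i)) -> sigma12 R (\bigcap_i A i).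
Proof.
move=> /(_ _)/sigma12P/= sA.
have {sA}/choice[B AB] : forall i, exists B : set (T * R * R), measurable B /\
    A i = [set x | exists y, forall z, B (x, y, z)].
  by move=> i; have [B] := sA i; exists B.
apply/sigma12P.
pose f (i : J) (p : T * R * R) := (p.1.1, real_code (pickle i) p.1.2, p.2).
exists (\bigcap_i (f i @^-1` B i)).
  rewrite -[X in measurable X]setCK; apply: measurableC; rewrite setC_bigcap.
  apply: countable_bigcupT_measurable => // i; apply: measurableC.
  apply: measurable_preimage (AB i).1.
  apply: measurable_fun_pair => //; apply: measurable_fun_pair.
    exact: measurableT_comp.
  exact: measurableT_comp (measurable_real_code _) (measurableT_comp _ _).
apply/seteqP; split => x; last first.
  move=> [y By] i _; rewrite (AB i).2; exists (real_code (pickle i) y) => z.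
  exact: By.
move=> Ax; have /choice[w Bw] : forall i, exists y, forall z, B i (x, y, z).
  by move=> i; have := Ax i I; rewrite (AB i).2.
have [y yw] :=
  real_code_surj (fun n => if unpickle n is Some i then w i else 0).
by exists y => z i _; rewrite /f /= yw pickleK; exact: Bw.
Qed.

Lemma sigma12_setI d (T : measurableType d) (A B : set T) :
  sigma12 R A -> sigma12 R B -> sigma12 R (A `&` B).
Proof.
move=> sA sB; have -> : A `&` B = \bigcap_(b : bool) (if b then A else B).
  apply/seteqP; split => [x [Ax Bx] []//|x ABx].
  by split; [exact: (ABx true)|exact: (ABx false)].
by apply: sigma12_bigcap => -[].
Qed.

(** The quantified variable ranges over any Borel image S of R, so that both R
    and \bar R are covered; its code and the existential real of the prenex form
    are merged into a single real. *)
Lemma sigma12_exists d d' (T : measurableType d) (S : measurableType d')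
  (g : R -> S) (A : set (T * S)) :
  measurable_fun setT g -> (forall s, exists y, g y = s) ->
  sigma12 R A -> sigma12 R [set x | exists s, A (x, s)].
Proof.
move=> mg g_surj /sigma12P[B mB ->]; apply/sigma12P.
exists ((fun p : T * R * R =>
  (p.1.1, g (real_code 0 p.1.2), real_code 1 p.1.2, p.2)) @^-1` B).
  apply: measurable_preimage mB.
  have mcode n : measurable_fun setT (fun p : T * R * R => real_code n p.1.2).
    exact: measurableT_comp (measurable_real_code _) (measurableT_comp _ _).
  apply: measurable_fun_pair => //; apply: measurable_fun_pair => //.
  apply: measurable_fun_pair; first exact: measurableT_comp.
  exact: measurableT_comp mg (mcode 0%N).
apply/seteqP; split => x /=.
  move=> [s [y Bsy]]; have [a gas] := g_surj s.
  have [v vE] := real_code_surj (fun n => if n == 0%N then a else y).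
  by exists v => z; rewrite !vE /= gas.
by move=> [v Bv]; exists (g (real_code 0 v)), (real_code 1 v).
Qed.

Lemma sigma12_projection d (T : measurableType d) (A : set (T * R)) :
  sigma12 R A -> sigma12 R (projection A).
Proof.
apply: (@sigma12_exists _ _ _ _ id); first exact: measurable_id.
by move=> s; exists s.
Qed.

End sigma12_closure.

(** * Limits along ultrafilters in the extended line *)

Section ereal_limits.
Context {R : realType} {T : Type}.
Implicit Types (F : set_system T) (f : T -> \bar R) (L : \bar R).
Local Open Scope ereal_scope.

(** The open rays with rational endpoints are a subbase of the topology of
    \bar R, so convergence amounts to countably many conditions. *)
Lemma ereal_cvg_ratP F f L : Filter F ->
  f @ F --> L <-> forall q : rat,
    ((ratr q)%:E < L -> F [set n | (ratr q)%:E < f n]) /\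
    (L < (ratr q)%:E -> F [set n | f n < (ratr q)%:E]).
Proof.
move=> FF; split=> [fL q|rays V].
  split=> qL; first exact: (fL _ (open_ereal_gt' qL)).
  exact: (fL _ (open_ereal_lt' qL)).
have gt x : x < L -> F [set n | x < f n].
  move=> /ereal_rat_between[q /andP[xq /(rays q).1]].
  by apply: filterS => n; exact: lt_trans.
have lt x : L < x -> F [set n | f n < x].
  move=> /ereal_rat_between[q /andP[/(rays q).2 + qx]].
  by apply: filterS => n /= fq; exact: lt_trans qx.
rewrite itv_nbhsE => -[i [iopen Li] iV].
apply: (filterS (P := f @^-1` [set` i])).
  by move=> n; exact: iV.
case: i iopen Li {iV} => [[[]a|[]] [[]b|[]]] //= _;
  rewrite in_itv ?andbT /=.
- move=> /andP[/gt Fa /lt Fb]; apply: filterS (filterI Fa Fb) => n [/= an nb].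
  by rewrite /= in_itv /= an.
- by move=> /gt; apply: filterS => n /=; rewrite in_itv /= andbT.
- by move=> /lt; apply: filterS => n /=; rewrite in_itv.
- by move=> _; apply: filterS filterT => n _ /=; rewrite in_itv.
Qed.

(** The limit is the supremum of the x that are exceeded F-often; F being an
    ultrafilter, each real above it bounds f on a member of F. *)
Lemma ultra_ereal_cvg F f : UltraFilter F -> cvg (f @ F).
Proof.
move=> UF; pose L := ereal_sup [set x | F [set n | x < f n]].
apply/cvg_ex; exists L; apply/ereal_cvg_ratP => q; split.
  move=> /ereal_sup_gt[x + qx]; apply: filterS => n /=; exact: lt_trans.
move=> /ereal_rat_between[r /andP[Lr rq]].
have [Fr|] := in_ultra_setVsetC [set n | (ratr r)%:E < f n] UF.
  have : (ratr r)%:E <= L by exact: ereal_sup_ubound.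
  by rewrite leNgt Lr.
by apply: filterS => n /= /negP; rewrite -leNgt => /le_lt_trans; exact.
Qed.

End ereal_limits.

(** * The kernel *)

Section ultra_kernel_sigma12.
Context {R : realType}.
Context (h phi : R -> R) (U : set_system nat).
Context (h_sigma12 : sigma12 R (graph [set: R] h)).
Context (U_ultra : UltraFilter U).
Context (U_sigma12 : sigma12 R (reals_of_family R U)).

Let increment n t : R := h (n%:R + t * phi n%:R) - h n%:R.

(** The value h (n%:R + t * phi n%:R) is the only one that varies with t;
    quantifying over it brings in the graph of h. *)
Lemma increment_sigma12 n (V : set R) :
  measurable V -> sigma12 R [set t | V (increment n t)].
Proof.
move=> mV.
have -> : [set t | V (increment n t)] = projection
    ([set p : R * R | graph setT h (n%:R + p.1 * phi n%:R, p.2)] `&`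
     [set p : R * R | V (p.2 - h n%:R)]).
  apply/seteqP; split => t /=; first by exists (h (n%:R + t * phi n%:R)).
  by move=> [u [[_ /= ->]]].
apply/sigma12_projection/sigma12_setI.
  apply: (sigma12_preimage
    (f := fun p : R * R => (n%:R + p.1 * phi n%:R, p.2)) _ h_sigma12).
  apply: measurable_fun_pair => //; apply: measurable_funD => //.
  exact: measurable_funM.
apply: measurable_sigma12.
apply: (measurable_preimage (f := fun p : R * R => p.2 - h n%:R)) mV.
exact: measurable_funB.
Qed.

(** Asking for some A in U inside {n | f_n(t) in V}, instead of that set
    itself, leaves f_n(t) in V in positive position only; hence each n
    contributes a Sigma^1_2 condition. *)
Lemma ultra_increment_sigma12 (V : set R) :
  measurable V -> sigma12 R [set t | U [set n | V (increment n t)]].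
Proof.
move=> mV; have -> : [set t | U [set n | V (increment n t)]] = projection
    ([set p : R * R | reals_of_family R U p.2] `&` \bigcap_(n : nat)
      ([set p : R * R | ~ ternary_digit n p.2] `|`
       [set p : R * R | V (increment n p.1)])).
  apply/seteqP; split => t /=.
    move=> Ut; exists (real_of_natset R [set n | V (increment n t)]).
    split; first by exists [set n | V (increment n t)].
    move=> n _ /=; have [|nV] := pselect (V (increment n t)); first by right.
    by left; rewrite ternary_digit_real_of_natset.
  move=> [y [/= [A UA yA] AV]]; apply: filterS UA => n An.
  by have [/= []|//] := AV n Logic.I; rewrite -yA ternary_digit_real_of_natset.
apply/sigma12_projection/sigma12_setI.
  exact: (sigma12_preimage (f := snd) _ U_sigma12).
apply: sigma12_bigcap => n; apply: sigma12_setU_measurable.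
  apply: measurableC.
  by apply: (measurable_preimage (f := snd)) (measurable_ternary_digit n).
by apply: (sigma12_preimage (f := fst)) (increment_sigma12 n mV).
Qed.

Lemma graph_ultra_kernel_sigma12 :
  sigma12 R (graph [set: R] (ultra_kernel U h phi)).
Proof.
(* Each implication of [ereal_cvg_ratP] has a Borel premise on L, so it is the
   union of a Borel set and a Sigma^1_2 set. *)
have -> : graph [set: R] (ultra_kernel U h phi) = \bigcap_(q : rat) (
    ([set p : R * \bar R | (p.2 <= (ratr q)%:E)%E] `|`
     [set p : R * \bar R |
       U [set n | `]ratr q, +oo[%classic (increment n p.1)]]) `&`
    ([set p : R * \bar R | ((ratr q)%:E <= p.2)%E] `|`
     [set p : R * \bar R |
       U [set n | `]-oo, ratr q[%classic (increment n p.1)]])).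
  apply/seteqP; split => -[t L] /=.
    move=> [_ /= ->] q _.
    have /ereal_cvg_ratP/(_ q)[] : (fun n => (increment n t)%:E) @ U -->
      ultra_kernel U h phi t by exact: ultra_ereal_cvg.
    by move=> gt lt; split => /=; [have [|/gt] := leP _ (ratr q)%:E
      |have [|/lt] := leP (ratr q)%:E _]; (try by left); move=> Uq; right;
      apply: filterS Uq => n /=; rewrite in_itv /= ?andbT lte_fin.
  move=> rays; split => //=; apply/esym/cvg_lim => //.
  apply/ereal_cvg_ratP => q; have [gt lt] := rays q Logic.I; split => qL.
    case: gt => [/=|]; first by rewrite leNgt qL.
    by apply: filterS => n /=; rewrite in_itv /= andbT lte_fin.
  case: lt => [/=|]; first by rewrite leNgt qL.
  by apply: filterS => n /=; rewrite in_itv /= lte_fin.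
apply: sigma12_bigcap => q; apply: sigma12_setI;
    apply: sigma12_setU_measurable.
- apply: (measurable_preimage (f := snd) (B := [set x | (x <= _)%E])) => //.
  by rewrite -set_itvNyc; exact: emeasurable_itv.
- apply: (sigma12_preimage (f := fst)
    (A := [set t | U [set n | `]ratr q, +oo[%classic (increment n t)]])) => //.
  exact: ultra_increment_sigma12.
- apply: (measurable_preimage (f := snd) (B := [set x | (_ <= x)%E])) => //.
  by rewrite -set_itvcy; exact: emeasurable_itv.
- apply: (sigma12_preimage (f := fst)
    (A := [set t | U [set n | `]-oo, ratr q[%classic (increment n t)]])) => //.
  exact: ultra_increment_sigma12.
Qed.

End ultra_kernel_sigma12.

(** As f is total and single-valued, being off its graph is an existential
    statement, some other point being the value; thus complementation does not
    leave the class. *)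
Lemma sigma12_graphC (R : realType) d (T : measurableType d) (f : T -> \bar R) :
  sigma12 R (graph [set: T] f) -> sigma12 R (~` graph [set: T] f).
Proof.
move=> sf; have -> : ~` graph [set: T] f = [set p | exists y : \bar R,
    ([set q : T * \bar R * \bar R | graph setT f (q.1.1, q.2)] `&`
     [set q : T * \bar R * \bar R | q.1.2 != q.2]) (p, y)].
  apply/seteqP; split => -[t L] /=.
    by move=> nf; exists (f t); split => //; apply/eqP => Lf; apply: nf.
  by move=> [y [[_ /= ->]] /eqP nLf] [_ /= /nLf].
(* The other value ranges over \bar R, parametrized by the first coded term. *)
apply: (sigma12_exists (g := ereal_code 0)).
- exact: measurable_ereal_code.
- move=> x; have [y yx] := ereal_code_surj (fun=> x).
  by exists y; exact: yx.
apply: sigma12_setI.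
  apply: (sigma12_preimage
    (f := fun q : T * \bar R * \bar R => (q.1.1, q.2)) _ sf).
  by apply: measurable_fun_pair => //; exact: measurableT_comp.
apply: measurable_sigma12.
rewrite -[X in measurable X]setTI; apply: measurable_neqe => //.
exact: measurableT_comp.
Qed.

Theorem theorem13 (R : realType) (h phi : R -> R) (U : set_system nat)
  (phi_gt0 : forall x : R, 0 < x -> 0 < phi x)
  (h_delta12 : delta12 R (graph [set: R] h))
  (phi_delta12 : delta12 R (graph [set x : R | 0 < x] phi))
  (U_ultra : UltraFilter U)
  (U_delta12 : delta12 R (reals_of_family R U)) :
  delta12 R (graph [set: R] (ultra_kernel U h phi)).
Proof.
have sK := graph_ultra_kernel_sigma12 phi h_delta12.1 U_ultra U_delta12.1.
by split=> //; exact: sigma12_graphC.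
Qed.
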